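(* Let $(\mathsf{Q},\&)$ be a commutative, unital and divisible quantale. Then the category $\mathsf{Q}\text{-}\mathbf{Set}$ of $\mathsf{Q}$-sets and left adjoint $\mathsf{D}\mathsf{Q}$-distributors is a topos if, and only if, $\mathsf{Q}$ is a frame.
   Context: A commutative and unital quantale is a commutative monoid $(\mathsf{Q},\&,1)$ whose underlying set is a complete lattice (top $\top$, bottom $\bot$) such that $p\& (\bigvee_{i\in I}q_i)=\bigvee_{i\in I}p\& q_i$ for all $p,q_i\in\mathsf{Q}$. The residual $\to$ is determined by $p\& q\leq r\iff p\leq q\to r$. It is divisible if $u=q\&(q\to u)$ whenever $u\leq q$ (this forces $1=\top$). ''$\mathsf{Q}$ is a frame'' means that the multiplication is the binary meet, $\&=\wedge$ (equivalently, every $q\in\mathsf{Q}$ satisfies $q\& q=q$). ''Topos'' means elementary topos. A $\mathsf{Q}$-set is a set $X$ with a map $\alpha\colon X\times X\to\mathsf{Q}$ such that for all $x,y,z\in X$: $\alpha(x,y)\leq\alpha(x,x)\wedge\alpha(y,y)$; $\alpha(x,y)=\alpha(y,x)$; $\alpha(y,z)\&(\alpha(y,y)\to\alpha(x,y))\leq\alpha(x,z)$. For $\mathsf{Q}$-sets $(X,\alpha)$, $(Y,\beta)$, a $\mathsf{D}\mathsf{Q}$-distributor $\phi$ from $(X,\alpha)$ to $(Y,\beta)$ is a map $\phi\colon X\times Y\to\mathsf{Q}$ such that for all $x,x'\in X$, $y,y'\in Y$: $\phi(x,y)\leq\alpha(x,x)\wedge\beta(y,y)$; $\beta(y,y')\&(\beta(y,y)\to\phi(x,y))\leq\phi(x,y')$;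 $\phi(x,y)\&(\alpha(x,x)\to\alpha(x',x))\leq\phi(x',y)$. The composite of $\phi$ from $(X,\alpha)$ to $(Y,\beta)$ and $\psi$ from $(Y,\beta)$ to $(Z,\gamma)$ is $(\psi\circ\phi)(x,z)=\bigvee_{y\in Y}\psi(y,z)\&(\beta(y,y)\to\phi(x,y))$, and the identity on $(X,\alpha)$ is $\alpha$. Distributors are ordered pointwise. $\phi$ from $(X,\alpha)$ to $(Y,\beta)$ is a left adjoint if there is a distributor $\psi$ from $(Y,\beta)$ to $(X,\alpha)$ with $\alpha\leq\psi\circ\phi$ and $\phi\circ\psi\leq\beta$. $\mathsf{Q}\text{-}\mathbf{Set}$ is the category whose objects are $\mathsf{Q}$-sets and whose morphisms are left adjoint $\mathsf{D}\mathsf{Q}$-distributors, with composition $(\psi\circ\phi)(x,z)=\bigvee_{y\in Y}\psi(y,z)\&(\beta(y,y)\to\phi(x,y))$ for $\phi$ from $(X,\alpha)$ to $(Y,\beta)$ and $\psi$ from $(Y,\beta)$ to $(Z,\gamma)$, and with $\alpha$ as the identity on $(X,\alpha)$. *)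

(* Defs.v *)
From HB Require Import structures.
From mathcomp Require Import all_boot all_order.
From mathcomp Require Import boolp classical_sets.

Set Implicit Arguments.
Unset Strict Implicit.
Unset Printing Implicit Defensive.

Import Order.TTheory.
Local Open Scope classical_set_scope.
Local Open Scope order_scope.
Local Open Scope group_scope.

HB.mixin Record hasAllSups d L of Order.Lattice d L := {
  Sup : set L -> L;
  Sup_isLub : forall A : set L, isLub A (Sup A)
}.

#[short(type="completeLatticeType")]
HB.structure Definition CompleteLattice d :=
  {L of hasAllSups d L & Order.Lattice d L}.

HB.mixin Record isCommQuantale d Q of Monoid Q & CompleteLattice d Q := {
  qmulC : commutative (@mul Q);
  qmulSup : forall (p : Q) (A : set Q), p * Sup A = Sup [set p * q | q in A]
}.

(** Commutative unital quantales: [x * y] and [1] are those of [monoidType],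
    [x <= y] and [Order.meet] those of [latticeType]. *)
#[short(type="commQuantaleType")]
HB.structure Definition CommQuantale d :=
  {Q of isCommQuantale d Q & Monoid Q & CompleteLattice d Q}.

Definition resid d (Q : commQuantaleType d) (p q : Q) : Q :=
  Sup [set r | p * r <= q].

Notation "p ~> q" := (resid p q) (at level 55, right associativity).

(** Divisibility forces [1] to be the top element, see [le_q1]. *)
Definition divisible d (Q : commQuantaleType d) :=
  forall u q : Q, u <= q -> u = q * (q ~> u).

Definition is_frame d (Q : commQuantaleType d) :=
  forall p q : Q, p * q = Order.meet p q.

Section QuantaleTheory.
Context {d : Order.disp_t} {Q : commQuantaleType d}.
Implicit Types (p q r s u : Q) (A : set Q).

Lemma Sup_ub A q : A q -> q <= Sup A.
Proof. by case: (Sup_isLub A) => + _; apply. Qed.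

Lemma Sup_le A q : (forall p, A p -> p <= q) -> Sup A <= q.
Proof. by case: (Sup_isLub A) => _; apply. Qed.

Lemma le_Sup A p q : p <= q -> A q -> p <= Sup A.
Proof. by move=> pq /Sup_ub; apply: le_trans. Qed.

Lemma qmulSupl p A : Sup A * p = Sup [set q * p | q in A].
Proof.
rewrite qmulC qmulSup; congr Sup.
by apply/seteqP; split=> _ [q Aq <-]; exists q => //; rewrite qmulC.
Qed.

Lemma qmul_le2l p q r : q <= r -> p * q <= p * r.
Proof.
move=> qr.
have -> : r = Sup [set q; r].
  apply/le_anti/andP; split; first by apply: Sup_ub; right.
  by apply: Sup_le => s [->|->].
by rewrite qmulSup; apply: Sup_ub; exists q => //; left.
Qed.

Lemma qmul_le2r p q r : q <= r -> q * p <= r * p.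
Proof. by move=> qr; rewrite ![_ * p]qmulC; apply: qmul_le2l. Qed.

Lemma qmul_le p q r s : p <= q -> r <= s -> p * r <= q * s.
Proof. by move=> pq rs; apply: le_trans (qmul_le2l _ rs) (qmul_le2r _ pq). Qed.

Lemma qmul_resid p q : p * (p ~> q) <= q.
Proof. by rewrite /resid qmulSup; apply: Sup_le => _ [r pr <-]. Qed.

Lemma residP p q r : (p * q <= r) <-> (q <= p ~> r).
Proof.
split=> [pqr|qpr]; first by apply: Sup_ub.
exact: le_trans (qmul_le2l _ qpr) (qmul_resid _ _).
Qed.

Lemma resid_le p q r : q <= r -> p ~> q <= p ~> r.
Proof. by move=> qr; apply/residP; apply: le_trans (qmul_resid _ _) qr. Qed.

Lemma one_le_resid q : 1 <= q ~> q.
Proof. by apply/residP; rewrite mulg1. Qed.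

Hypothesis Qdiv : divisible Q.

Lemma le_q1 q : q <= 1.
Proof.
pose t : Q := Sup setT.
have t_ub p : p <= t by apply: Sup_ub.
suff t1 : t <= 1 by apply: le_trans (t_ub _) t1.
have e : 1 = t * (t ~> 1) by apply: Qdiv.
rewrite -{1}(mulg1 t) {1}e mulgA.
by apply: le_trans (qmul_le2r _ (t_ub _)) _; rewrite -e.
Qed.

Lemma qmul_lel p q : p * q <= p.
Proof. by rewrite -{2}(mulg1 p); apply/qmul_le2l/le_q1. Qed.

Lemma qmul_ler p q : p * q <= q.
Proof. by rewrite qmulC qmul_lel. Qed.

Lemma resid_swap q u v : u <= q -> v <= q -> u * (q ~> v) = v * (q ~> u).
Proof.
move=> uq vq; rewrite {1}(Qdiv uq) {2}(Qdiv vq) -!mulgA.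
by rewrite (qmulC (q ~> u)).
Qed.

End QuantaleTheory.

Section QSets.
Context {d : Order.disp_t} {Q : commQuantaleType d}.

Record qset := QSet {
  qcar :> Type;
  qeq : qcar -> qcar -> Q;
  qeq_extent : forall x y, qeq x y <= Order.meet (qeq x x) (qeq y y);
  qeq_sym : forall x y, qeq x y = qeq y x;
  qeq_trans : forall x y z, qeq y z * (qeq y y ~> qeq x y) <= qeq x z
}.

Record distributor (X Y : qset) (phi : X -> Y -> Q) : Prop := Distributor {
  dist_extent : forall x y, phi x y <= Order.meet (qeq x x) (qeq y y);
  dist_right : forall x y y', qeq y y' * (qeq y y ~> phi x y) <= phi x y';
  dist_left : forall x x' y, phi x y * (qeq x x ~> qeq x' x) <= phi x' y
}.

Definition dcomp (X Y Z : qset) (psi : Y -> Z -> Q) (phi : X -> Y -> Q) :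
    X -> Z -> Q :=
  fun x z => Sup (range (fun y : Y => psi y z * (qeq y y ~> phi x y))).

Definition dle (X Y : qset) (phi psi : X -> Y -> Q) :=
  forall x y, phi x y <= psi x y.

Definition left_adjoint (X Y : qset) (phi : X -> Y -> Q) :=
  distributor phi /\
  exists psi : Y -> X -> Q,
    [/\ distributor psi, dle (@qeq X) (dcomp psi phi)
      & dle (dcomp phi psi) (@qeq Y)].

Record qhom (X Y : qset) := QHom {
  qdist :> X -> Y -> Q;
  qdist_adjoint : left_adjoint qdist
}.

Lemma qhom_eq (X Y : qset) (f g : qhom X Y) :
  (forall x y, f x y = g x y) -> f = g.
Proof.
case: f g => [f fa] [g ga] /= fg.
have e : f = g by apply/funext => x; apply/funext => y.
by case: _ / e ga => ga; congr QHom; apply: Prop_irrelevance.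
Qed.

Lemma dcomp_ub (X Y Z : qset) (psi : Y -> Z -> Q) (phi : X -> Y -> Q) x y z :
  psi y z * (qeq y y ~> phi x y) <= dcomp psi phi x z.
Proof. by apply: Sup_ub; exists y. Qed.

Lemma dcomp_le (X Y Z : qset) (psi : Y -> Z -> Q) (phi : X -> Y -> Q) x z q :
  (forall y, psi y z * (qeq y y ~> phi x y) <= q) -> dcomp psi phi x z <= q.
Proof. by move=> h; apply: Sup_le => _ [y _ <-]. Qed.

Lemma dle_comp (X Y Z : qset) (psi psi' : Y -> Z -> Q) (phi phi' : X -> Y -> Q) :
  dle psi psi' -> dle phi phi' -> dle (dcomp psi phi) (dcomp psi' phi').
Proof.
move=> h k x z; apply: dcomp_le => y; apply: le_trans (dcomp_ub _ _ _ y _).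
by apply: qmul_le (h _ _) (resid_le _ (k _ _)).
Qed.

Lemma dist_extl (X Y : qset) (phi : X -> Y -> Q) x y :
  distributor phi -> phi x y <= qeq x x.
Proof. by move=> /dist_extent/(_ x y); rewrite lexI => /andP[]. Qed.

Lemma dist_extr (X Y : qset) (phi : X -> Y -> Q) x y :
  distributor phi -> phi x y <= qeq y y.
Proof. by move=> /dist_extent/(_ x y); rewrite lexI => /andP[]. Qed.

Lemma qeq_distributor (X : qset) : distributor (@qeq X).
Proof. by split=> *; [exact: qeq_extent | exact: qeq_trans ..]. Qed.

Hypothesis Qdiv : divisible Q.

Lemma dcompE (X Y Z : qset) (psi : Y -> Z -> Q) (phi : X -> Y -> Q) x z :
  distributor psi -> distributor phi ->
  dcomp psi phi x z =
  Sup (range (fun y : Y => phi x y * (qeq y y ~> psi y z))).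
Proof.
move=> dpsi dphi; congr Sup; apply: eq_imagel => y _.
by apply: resid_swap => //; [apply: dist_extl | apply: dist_extr].
Qed.

Lemma dcomp_distributor (X Y Z : qset) (psi : Y -> Z -> Q) (phi : X -> Y -> Q) :
  distributor psi -> distributor phi -> distributor (dcomp psi phi).
Proof.
move=> dpsi dphi.
have extl x z : dcomp psi phi x z <= qeq x x.
  rewrite dcompE //; apply: Sup_le => _ [y _ <-].
  by apply: le_trans (qmul_lel Qdiv _ _) (dist_extl _ _ dphi).
have extr x z : dcomp psi phi x z <= qeq z z.
  apply: dcomp_le => y.
  by apply: le_trans (qmul_lel Qdiv _ _) (dist_extr _ _ dpsi).
split=> [x z|x z z'|x x' z]; first by rewrite lexI extl extr.
- have zz' : qeq z z' <= qeq z z.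
    exact: (dist_extl _ _ (qeq_distributor Z)).
  rewrite (resid_swap Qdiv zz' (extr x z)) qmulSupl.
  apply: Sup_le => _ [_ [y _ <-] <-]; apply: le_trans (dcomp_ub _ _ _ y _).
  rewrite -mulgA (qmulC (_ ~> phi _ _)) mulgA; apply: qmul_le2r.
  rewrite (resid_swap Qdiv (dist_extr y z dpsi) zz').
  exact: dist_right dpsi _ _ _.
- rewrite [dcomp psi phi x z]dcompE // [dcomp psi phi x' z]dcompE // qmulSupl.
  apply: Sup_le => _ [_ [y _ <-] <-]; apply: (@le_Sup _ _ _ _ _ _ (imageT _ y)).
  rewrite -mulgA (qmulC (_ ~> psi _ _)) mulgA; apply: qmul_le2r.
  exact: dist_left dphi _ _ _.
Qed.

Lemma dcomp_idl (X Y : qset) (phi : X -> Y -> Q) :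
  distributor phi -> dcomp (@qeq Y) phi = phi.
Proof.
move=> dphi; apply/funext => x; apply/funext => y.
apply/le_anti/andP; split; first by apply: dcomp_le => y'; apply: dist_right.
apply: le_trans (dcomp_ub _ _ _ y _).
by rewrite -(Qdiv (dist_extr x y dphi)).
Qed.

Lemma dcomp_idr (X Y : qset) (phi : X -> Y -> Q) :
  distributor phi -> dcomp phi (@qeq X) = phi.
Proof.
move=> dphi; apply/funext => x; apply/funext => y.
apply/le_anti/andP; split; first by apply: dcomp_le => x'; apply: dist_left.
apply: le_trans (dcomp_ub _ _ _ x _).
by rewrite -{1}(mulg1 (phi x y)); apply/qmul_le2l/one_le_resid.
Qed.

Lemma dcompA (X Y Z W : qset) (xi : Z -> W -> Q) (psi : Y -> Z -> Q)
    (phi : X -> Y -> Q) :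
  distributor xi -> distributor psi -> distributor phi ->
  dcomp xi (dcomp psi phi) = dcomp (dcomp xi psi) phi.
Proof.
move=> dxi dpsi dphi; have dpp := dcomp_distributor dpsi dphi.
apply/funext => x; apply/funext => w; rewrite dcompE //.
apply/le_anti/andP; split.
- apply: Sup_le => _ [z _ <-]; rewrite qmulSupl.
  apply: Sup_le => _ [_ [y _ <-] <-]; apply: le_trans (dcomp_ub _ _ _ y _).
  rewrite -mulgA (qmulC (_ ~> phi _ _)) mulgA; apply: qmul_le2r.
  rewrite (resid_swap Qdiv (dist_extr y z dpsi) (dist_extl z w dxi)).
  exact: dcomp_ub.
- apply: dcomp_le => y; rewrite qmulSupl.
  apply: Sup_le => _ [_ [z _ <-] <-].
  apply: (@le_Sup _ _ _ _ _ _ (imageT _ z)).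
  rewrite (resid_swap Qdiv (dist_extl z w dxi) (dist_extr y z dpsi)).
  rewrite -mulgA (qmulC (_ ~> xi _ _)) mulgA; apply: qmul_le2r.
  exact: dcomp_ub.
Qed.

Lemma qeq_adjoint (X : qset) : left_adjoint (@qeq X).
Proof.
have dX := qeq_distributor X.
by split=> //; exists (@qeq X); split=> //; rewrite dcomp_idl // => x y; exact: lexx.
Qed.

Lemma dcomp_adjoint (X Y Z : qset) (psi : Y -> Z -> Q) (phi : X -> Y -> Q) :
  left_adjoint psi -> left_adjoint phi -> left_adjoint (dcomp psi phi).
Proof.
move=> [dpsi [psi' [dpsi' upsi cpsi]]] [dphi [phi' [dphi' uphi cphi]]].
have dlexx (A B : qset) (f : A -> B -> Q) : dle f f by move=> x y; exact: lexx.
split; first exact: dcomp_distributor.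
exists (dcomp phi' psi'); split; first exact: dcomp_distributor.
- rewrite -dcompA //; last exact: dcomp_distributor.
  rewrite (dcompA dpsi') // => x x'; apply: le_trans (uphi x x') _.
  apply: dle_comp x x'; first exact: dlexx.
  by rewrite -{1}(dcomp_idl dphi); apply: dle_comp.
- rewrite -dcompA //; last exact: dcomp_distributor.
  rewrite (dcompA dphi) // => z z'; apply: le_trans (cpsi z z').
  apply: dle_comp z z'; first exact: dlexx.
  by rewrite -{2}(dcomp_idl dpsi'); apply: dle_comp.
Qed.

End QSets.

Arguments qset {d} Q.

Record category := Category {
  obj :> Type;
  hom : obj -> obj -> Type;
  idm : forall a, hom a a;
  comp : forall a b c, hom b c -> hom a b -> hom a c;
  comp_idl : forall a b (f : hom a b), comp (idm b) f = f;
  comp_idr : forall a b (f : hom a b), comp f (idm a) = f;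
  compA : forall a b c e (h : hom c e) (g : hom b c) (f : hom a b),
    comp h (comp g f) = comp (comp h g) f
}.

Notation "g \oc f" := (comp g f) (at level 50, left associativity).

Section Topos.
Context {C : category}.
Implicit Types a b c e p q t : C.

Definition mono a b (m : hom a b) :=
  forall c (f g : hom c a), m \oc f = m \oc g -> f = g.

Definition is_terminal t := forall a, exists! f : hom a t, True.

Definition is_product a b p (p1 : hom p a) (p2 : hom p b) :=
  forall c (f : hom c a) (g : hom c b),
    exists! h : hom c p, p1 \oc h = f /\ p2 \oc h = g.

Definition is_pullback a b c (f : hom a c) (g : hom b c)
    p (p1 : hom p a) (p2 : hom p b) :=
  f \oc p1 = g \oc p2 /\
  forall q (q1 : hom q a) (q2 : hom q b), f \oc q1 = g \oc q2 ->
    exists! h : hom q p, p1 \oc h = q1 /\ p2 \oc h = q2.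

(** [e] is [b ^ a]: [p] is a product [e * a], and every [f : c * a -> b] is
    [ev \o (g * a)] for a unique [g : c -> e]; [h] below is [g * a]. *)
Definition is_exponential a b e p (p1 : hom p e) (p2 : hom p a)
    (ev : hom p b) :=
  is_product p1 p2 /\
  forall c q (q1 : hom q c) (q2 : hom q a), is_product q1 q2 ->
    forall f : hom q b, exists! g : hom c e,
      exists h : hom q p,
        [/\ p1 \oc h = g \oc q1, p2 \oc h = q2 & ev \oc h = f].

Definition is_subobject_classifier t om (tr : hom t om) :=
  is_terminal t /\
  forall a b (m : hom a b), mono m ->
    exists! chi : hom b om, exists u : hom a t, is_pullback chi tr m u.

End Topos.

Definition has_terminal (C : category) := exists t : C, is_terminal t.

Definition has_pullbacks (C : category) :=
  forall (a b c : C) (f : hom a c) (g : hom b c),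
    exists p (p1 : hom p a) (p2 : hom p b), is_pullback f g p1 p2.

Definition has_exponentials (C : category) :=
  forall a b : C, exists e p (p1 : hom p e) (p2 : hom p a) (ev : hom p b),
    is_exponential p1 p2 ev.

Definition has_subobject_classifier (C : category) :=
  exists (t om : C) (tr : hom t om), is_subobject_classifier tr.

(** Lawvere-Tierney axioms; finite completeness is the existence of a terminal
    object and of pullbacks, hence binary products exist as well. *)
Definition elementary_topos (C : category) :=
  [/\ has_terminal C, has_pullbacks C, has_exponentials C
    & has_subobject_classifier C].

(** Divisibility is used to prove that left adjoint distributors compose
    associatively, so the category takes its proof as an argument. *)
Section QSetCategory.
Context {d : Order.disp_t} {Q : commQuantaleType d} (Qdiv : divisible Q).

Definition qhom_id (X : qset Q) : qhom X X := QHom (qeq_adjoint Qdiv X).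

Definition qhom_comp (X Y Z : qset Q) (psi : qhom Y Z) (phi : qhom X Y) :
    qhom X Z :=
  QHom (dcomp_adjoint Qdiv (qdist_adjoint psi) (qdist_adjoint phi)).

Lemma qhom_dist (X Y : qset Q) (phi : qhom X Y) : distributor phi.
Proof. by case: (qdist_adjoint phi). Qed.

Lemma qhom_idl (X Y : qset Q) (phi : qhom X Y) :
  qhom_comp (qhom_id Y) phi = phi.
Proof.
by apply: qhom_eq => x y; rewrite /= (dcomp_idl Qdiv (qhom_dist phi)).
Qed.

Lemma qhom_idr (X Y : qset Q) (phi : qhom X Y) :
  qhom_comp phi (qhom_id X) = phi.
Proof.
by apply: qhom_eq => x y; rewrite /= (dcomp_idr (qhom_dist phi)).
Qed.

Lemma qhom_compA (X Y Z W : qset Q) (xi : qhom Z W) (psi : qhom Y Z)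
    (phi : qhom X Y) :
  qhom_comp xi (qhom_comp psi phi) = qhom_comp (qhom_comp xi psi) phi.
Proof.
apply: qhom_eq => x w.
by rewrite /= (dcompA Qdiv (qhom_dist xi) (qhom_dist psi) (qhom_dist phi)).
Qed.

Definition QSetCat : category := Category qhom_idl qhom_idr qhom_compA.

End QSetCategory.

(* Main.v *)
Require Import Defs.
From mathcomp Require Import all_boot all_order.
From mathcomp Require Import classical_sets.

Set Implicit Arguments.
Unset Strict Implicit.
Unset Printing Implicit Defensive.

Import Order.TTheory.
Local Open Scope order_scope.
Local Open Scope group_scope.

(** Suppose that [Q]-sets form a topos. Every category with a subobject
    classifier is balanced: a mono that is also epi is an isomorphism. For
    [q : Q] let [e] be the largest idempotent below [q] (a supremum of
    idempotents is idempotent), and compare the sets with two points of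
    extent [1] whose equality is [e], respectively [q]. The identity on points
    is a left adjoint from the first to the second, and it is epi because it is
    bijective on points ([two_map_epi]). It is also mono ([two_map_mono]): a
    left adjoint [g] into the first set has two coordinates at each [z], and
    adjointness makes them, up to joining [e], idempotents whose product is
    [e] ([coord_idem], [coord_disjoint]). Composing with the map to the second
    set only blurs each coordinate by [q] times the other one, and a product of
    idempotents that lies below [q] already lies below [e], so the blur can be
    undone ([coord_le]). Hence the map is invertible, which forces [q <= e]: every
    [q] is idempotent, and in a divisible quantale multiplication by an
    idempotent is the meet.

    Conversely let [Q] be a frame. Then left adjoint distributors are exactly
    the [Q]-valued functional relations ([left_adjointP]): strict, extensional,
    single-valued and total, with relational composition. This is Higgs's
    description of the topos of sheaves on a frame, and the topos structure is
    the one of sets, read in the internal logic: a pullback is a part of the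
    product, [omega] is [Q] with logical equivalence as its equality, and the
    exponential consists of all relations, each existing to the degree to which
    it is functional. Arguments in the internal logic are carried out by forcing:
    [r <= p] is read as [r] forces [p], implication quantifies over smaller
    stages, and an existential statement provides a witness after passing to
    the stages of a cover ([force_ex_elim], and the tactic [pick]). *)

(** * Balance of categories with a subobject classifier *)

Definition epi (C : category) (a b : C) (m : hom a b) :=
  forall (c : C) (f g : hom b c), f \oc m = g \oc m -> f = g.

(** Since [m] is epi, its characteristic map is the one of the whole of [b], so
    the identity of [b] factors through [m]. *)
Lemma classifier_mono_epi_iso (C : category) (a b : C) (m : hom a b) :
  has_subobject_classifier C -> mono m -> epi m ->
  exists h : hom b a, m \oc h = idm b /\ h \oc m = idm a.
Proof.
move=> [t [om [tr [tT cl]]]] mm em.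
have [chi [[u [chim univ]] _]] := cl _ _ m mm.
have [v _] := tT b.
have vu : v \oc m = u.
  by have [w [_ wU]] := tT a; rewrite -(wU u) // -(wU (v \oc m)).
have chiE : chi = tr \oc v by apply: em; rewrite chim -vu Defs.compA.
have [|h [[mh _] _]] := univ b (idm b) v; first by rewrite comp_idr chiE.
exists h; split=> //; apply: mm.
by rewrite Defs.compA mh comp_idl comp_idr.
Qed.

(** * Idempotents of a divisible quantale *)

Section Idempotents.
Context {d : Order.disp_t} {Q : commQuantaleType d}.
Implicit Types (p q r s e u : Q).

Lemma resid1 q : 1 ~> q = q.
Proof.
apply/le_anti/andP; split; last by apply/residP; rewrite mul1g.
by rewrite -{1}(mul1g (1 ~> q)); apply: qmul_resid.
Qed.

Lemma qmulU_le p q r s : p * q <= s -> p * r <= s -> p * (q `|` r) <= s.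
Proof. by move=> pq pr; apply/residP; rewrite leUx; apply/andP; split; apply/residP. Qed.

Lemma qmulUl_le p q r s : q * p <= s -> r * p <= s -> (q `|` r) * p <= s.
Proof. by rewrite ![_ * p]qmulC; apply: qmulU_le. Qed.

Lemma qmulACA p q r s : (p * q) * (r * s) = (p * r) * (q * s).
Proof. by rewrite -!mulgA (mulgA q) (qmulC q) -(mulgA r). Qed.

Definition idem_core q : Q := Sup (fun r => r * r = r /\ r <= q).

Lemma idem_core_le q : idem_core q <= q.
Proof. by apply: Sup_le => r []. Qed.

Lemma idem_core_max q r : r * r = r -> r <= q -> r <= idem_core q.
Proof. by move=> rr rq; apply: Sup_ub. Qed.

Hypothesis Qdiv : divisible Q.

(** Idempotents are closed under suprema, since [r <= e] gives [r = r * r <= e * e]. *)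
Lemma idem_core_idem q : idem_core q * idem_core q = idem_core q.
Proof.
apply/le_anti/andP; split; first exact: qmul_lel.
apply: Sup_le => r [rr rq]; rewrite -{1}rr.
by apply: qmul_le; apply: idem_core_max.
Qed.

(** By divisibility an element below [e] is a multiple [e * u] of [e], and
    [e * (e * u) = e * u]. *)
Lemma idem_meet e q : e * e = e -> e `&` q = e * q.
Proof.
move=> ee; apply/le_anti/andP; split; last by rewrite lexI qmul_lel // qmul_ler.
have eq_e : e `&` q <= e by apply: leIl.
rewrite {1}(Qdiv eq_e) -{1}ee -mulgA -(Qdiv eq_e).
exact/qmul_le2l/leIr.
Qed.

(** The situation of a left adjoint into a two-point set, at one point of extent
    [p]: [a] and [b] are the values of the left adjoint, [a'] and [b'] those of
    its right adjoint. [unit_p] is the unit, and the last two hypotheses are the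
    counit at the two pairs of distinct points, whose equality is [e]. Modulo [e]
    the conclusions say that [a] is an idempotent equal to [a']. *)
Section SplitExtent.
Variables (p a a' b b' e : Q).
Hypotheses (ap : a <= p) (ap' : a' <= p) (bp : b <= p) (bp' : b' <= p).
Hypothesis unit_p : p <= a' * a `|` b' * b.
Hypotheses (abe : a * (p ~> b') <= e) (bae : b * (p ~> a') <= e).

Lemma split_le_mul : a <= a * a' `|` e.
Proof.
rewrite {1}(Qdiv ap); apply: le_trans (qmul_le2r _ unit_p) _.
apply: qmulUl_le; first by apply: lexUl; rewrite (qmulC a) qmul_lel.
apply: lexUr.
rewrite (qmulC b') -mulgA (resid_swap Qdiv bp' ap).
exact: le_trans (qmul_ler Qdiv _ _) abe.
Qed.

Lemma split_adjoint_le : a' <= a `|` e.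
Proof.
rewrite {1}(Qdiv ap'); apply: le_trans (qmul_le2r _ unit_p) _.
apply: qmulUl_le; rewrite -mulgA.
  exact: lexUl (le_trans (qmul_ler Qdiv _ _) (qmul_lel Qdiv _ _)).
exact: lexUr (le_trans (qmul_ler Qdiv _ _) bae).
Qed.

Lemma split_idem : e * e = e -> (a `|` e) * (a `|` e) = a `|` e.
Proof.
move=> ee; apply/le_anti/andP; split; first exact: qmul_lel.
have e_le : e <= (a `|` e) * (a `|` e) by rewrite -{1}ee; apply: qmul_le; apply: leUr.
rewrite leUx e_le andbT; apply: le_trans split_le_mul _.
by rewrite leUx e_le andbT; apply: qmul_le split_adjoint_le; apply: leUl.
Qed.

End SplitExtent.

End Idempotents.

(** * Two-point sets *)

Section TwoPoints.
Context {d : Order.disp_t} {Q : commQuantaleType d} (Qdiv : divisible Q).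
Implicit Types (q e : Q).

Definition two_eq q (i j : bool) : Q := if i == j then 1 else q.

Lemma two_eqxx q i : two_eq q i i = 1.
Proof. by rewrite /two_eq eqxx. Qed.

Lemma two_eq_trans q i j k :
  two_eq q j k * (two_eq q j j ~> two_eq q i j) <= two_eq q i k.
Proof.
rewrite two_eqxx resid1.
by case: i j k => [] [] []; rewrite /two_eq /= ?mulg1 ?mul1g ?le_q1.
Qed.

Definition two q : qset Q.
Proof.
apply: (@QSet _ Q bool (two_eq q)); last exact: two_eq_trans.
- by move=> i j; rewrite !two_eqxx lexI !le_q1.
- by move=> i j; rewrite /two_eq eq_sym.
Defined.

Section TwoMap.
Variables (e q : Q) (eq_le : e <= q).

Lemma two_eq_le i j : two_eq e i j <= two_eq q i j.
Proof. by rewrite /two_eq; case: ifP. Qed.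

Lemma two_eq_mul i j k : two_eq q j k * two_eq q i j <= two_eq q i k.
Proof. by have := two_eq_trans q i j k; rewrite two_eqxx resid1. Qed.

(** The right adjoint is the same matrix, read backwards. *)
Lemma two_map_adjoint : left_adjoint (two_eq q : two e -> two q -> Q).
Proof.
have dist_le i j r : two_eq r i j <= 1 `&` 1 by rewrite lexI le_q1.
split.
  split=> [i j|i j k|i j k] /=; rewrite ?two_eqxx ?resid1 //.
  - exact: two_eq_mul.
  - by apply: le_trans (two_eq_mul j i k); apply/qmul_le2l/two_eq_le.
exists (two_eq q); split.
- split=> [i j|i j k|i j k] /=; rewrite ?two_eqxx ?resid1 //.
  + by apply: le_trans (two_eq_mul i j k); apply/qmul_le2r/two_eq_le.
  + exact: two_eq_mul.
- move=> i j; apply: le_trans (two_eq_le i j) _ => /=.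
  apply: le_trans (dcomp_ub _ _ _ (i : two q) _) => /=.
  by rewrite !two_eqxx resid1 mulg1.
- by move=> i j; apply: dcomp_le => k /=; rewrite two_eqxx resid1 two_eq_mul.
Qed.

Definition two_map : qhom (two e) (two q) := QHom two_map_adjoint.

Lemma two_map_compE (Z : qset Q) (g : qhom Z (two e)) z i :
  dcomp two_map g z i = g z i `|` q * g z (~~ i).
Proof.
apply/le_anti/andP; split.
  apply: dcomp_le => j; rewrite /= two_eqxx resid1 /two_eq.
  by case: i j => [] [] /=; rewrite ?mul1g ?leUl ?leUr.
rewrite leUx; apply/andP; split.
  apply: le_trans (dcomp_ub _ _ _ (i : two e) _); rewrite /= !two_eqxx resid1.
  by rewrite mul1g.
apply: le_trans (dcomp_ub _ _ _ (~~ i : two e) _); rewrite /= !two_eqxx resid1 /two_eq.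
by case: i.
Qed.

Lemma two_map_precompE (Z : qset Q) (g : qhom (two q) Z) i z :
  dcomp g two_map i z = g i z.
Proof.
have dg := qhom_dist g; apply/le_anti/andP; split.
  by apply: dcomp_le => j; exact: dist_left dg _ _ _.
apply: le_trans (dcomp_ub _ _ _ (i : two q) _).
by rewrite /= !two_eqxx resid1 mulg1.
Qed.

Lemma two_map_epi : @epi (QSetCat Qdiv) _ _ two_map.
Proof.
move=> Z g h gh; apply: qhom_eq => i z.
by rewrite -!two_map_precompE; case: gh => ->.
Qed.

(** By [two_map_precompE] a left inverse has matrix [two_eq e], and this matrix
    extends along the equality [q] of the second set only if [q <= e]. *)
Lemma two_map_retract (h : qhom (two q) (two e)) :
  qhom_comp Qdiv h two_map = qhom_id Qdiv (two e) -> q <= e.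
Proof.
move=> hm; have hE i j : h i j = two_eq e i j.
  by rewrite -two_map_precompE -[dcomp _ _]/(qdist (qhom_comp Qdiv h two_map)) hm.
have := dist_left (qhom_dist h) true false true.
by rewrite !hE /= two_eqxx resid1 /two_eq /= mul1g.
Qed.

Section Coordinates.
Variables (Z : qset Q) (g : qhom Z (two e)) (z : Z).
Hypothesis ee : e * e = e.

Lemma coord_extent i : g z i <= qeq z z.
Proof. exact: dist_extl (qhom_dist g). Qed.

Lemma coord_adjoint : exists g' : bool -> Q,
  [/\ forall i, g' i <= qeq z z,
      forall i, qeq z z <= g' i * g z i `|` g' (~~ i) * g z (~~ i)
    & forall i, g z i * (qeq z z ~> g' (~~ i)) <= e].
Proof.
have [dg [g' [dg' ug cg]]] := qdist_adjoint g.
exists (fun i => g' i z); split=> i.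
- exact: dist_extr dg'.
- apply: le_trans (ug z z) _; apply: dcomp_le => j; rewrite /= two_eqxx resid1.
  by case: i j => [] []; rewrite ?leUl ?leUr.
- have := cg (~~ i) i; rewrite /= /two_eq; have -> : (~~ i == i) = false by case: i.
  by apply: le_trans; apply: (dcomp_ub g g' (~~ i : two e) z i).
Qed.

Lemma coord_idem i : (g z i `|` e) * (g z i `|` e) = g z i `|` e.
Proof.
have [g' [le' u c]] := coord_adjoint.
have ci := c (~~ i); rewrite negbK in ci.
exact: (split_idem Qdiv (coord_extent i) (le' i) (le' (~~ i)) (u i) (c i) ci).
Qed.

Lemma coord_disjoint i : (g z i `|` e) * (g z (~~ i) `|` e) <= e.
Proof.
have [g' [le' u c]] := coord_adjoint.
have ci := c (~~ i); have ui := u (~~ i); rewrite negbK in ci ui.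
apply: qmulUl_le; last exact: qmul_lel.
apply: qmulU_le; last exact: qmul_ler.
apply: le_trans (qmul_le2l _ (split_le_mul Qdiv (coord_extent _) _ ui ci)) _ => //.
apply: qmulU_le; last exact: qmul_ler.
apply: le_trans (qmul_le2l _ (qmul_ler Qdiv _ _)) _.
by apply: le_trans (c i); apply/qmul_le2l/residP; apply: qmul_ler.
Qed.

(** Below [e] the two points coincide, so there both coordinates are as large as
    the extent of [z] allows. *)
Lemma coord_core i : e * qeq z z <= g z i.
Proof.
have [g' [le' u c]] := coord_adjoint.
apply: le_trans (qmul_le2l _ (u i)) _; apply: qmulU_le.
  by rewrite mulgA qmul_ler.
apply: le_trans (dist_right (qhom_dist g) z (~~ i) i).
rewrite /= two_eqxx resid1 /two_eq.
have -> : (~~ i == i) = false by case: i.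
exact/qmul_le2l/(qmul_ler Qdiv).
Qed.

End Coordinates.

(** Joined with [e], the coordinates of [g] and of [h] are two pairs of disjoint
    idempotents. If coordinate [i] of [g] lies below coordinate [i] of [h] up to
    a blur by [q * d'], where [d'] is the other coordinate of [h], then its
    product with [d'] is an idempotent below [q], hence below [e], and the
    blur vanishes modulo [e]. Below [e] both coordinates are determined by
    the extent of [z] ([coord_core]), and divisibility glues the two
    comparisons. *)
Lemma coord_le (Z : qset Q) (g h : qhom Z (two e)) z i :
  e = idem_core q ->
  dcomp two_map g z i <= dcomp two_map h z i -> g z i <= h z i.
Proof.
move=> eE gh; have ee : e * e = e by rewrite eE; exact: idem_core_idem.
have := gh; rewrite !two_map_compE leUx => /andP[gih _].
pose c := g z i `|` e; pose d' := h z (~~ i) `|` e.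
have cc : c * c = c by apply: coord_idem.
have dd : d' * d' = d' by apply: coord_idem.
have hd : h z i * d' <= e.
  by apply: le_trans (coord_disjoint h z i); apply/qmul_le2r/leUl.
(* the hypothesis on [g], with [e] joined to both sides *)
have c_le : c <= h z i `|` e `|` q * d'.
  rewrite leUx; apply/andP; split; last by apply/lexUl/leUr.
  apply: le_trans gih _; rewrite leUx; apply/andP; split; first by apply/lexUl/leUl.
  by apply/lexUr/qmul_le2l/leUl.
have cd_e : c * d' <= e.
  rewrite eE; apply: idem_core_max; first by rewrite qmulACA cc dd.
  apply: le_trans (qmul_le2r _ c_le) _; apply: qmulUl_le.
    apply: qmulUl_le; first exact: le_trans hd eq_le.
    exact: le_trans (qmul_lel Qdiv _ _) eq_le.
  by rewrite -mulgA qmul_lel.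
have c_h : c <= h z i `|` e.
  rewrite -cc; apply: le_trans (qmul_le2l _ c_le) _.
  apply: qmulU_le; first exact: qmul_ler.
  apply/lexUr; apply: le_trans cd_e; exact/qmul_le2l/(qmul_ler Qdiv).
have g_h : g z i <= h z i `|` e by apply: le_trans c_h; apply: leUl.
rewrite (Qdiv g_h); apply: qmulUl_le; first exact: qmul_lel.
apply: le_trans (coord_core h z i).
rewrite -(idem_meet Qdiv (qeq z z) ee) lexI qmul_lel //=.
apply: le_trans (coord_extent g z i); rewrite {2}(Qdiv g_h).
exact/qmul_le2r/leUr.
Qed.

Lemma two_map_mono : e = idem_core q -> @mono (QSetCat Qdiv) _ _ two_map.
Proof.
move=> eE Z g h gh; apply: qhom_eq => z i.
have gh' j : dcomp two_map g z j = dcomp two_map h z j by case: gh => ->.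
by apply/le_anti/andP; split; apply: coord_le => //; rewrite gh'.
Qed.

End TwoMap.
End TwoPoints.

Lemma classifier_is_frame d (Q : commQuantaleType d) (Qdiv : divisible Q) :
  has_subobject_classifier (QSetCat Qdiv) -> is_frame Q.
Proof.
move=> om p q; rewrite -idem_meet //.
have le_p := idem_core_le p.
have [h [_ hm]] := classifier_mono_epi_iso om
  (@two_map_mono _ _ Qdiv _ _ le_p erefl) (@two_map_epi _ _ Qdiv _ _ le_p).
have -> : p = idem_core p.
  by apply/le_anti; rewrite le_p andbT (two_map_retract hm).
exact: idem_core_idem.
Qed.

(** * Exponentials from chosen products *)

(** Any two products of [c] and [a] are isomorphic over the projections, so the
    universal property of an exponential may be tested on a chosen product. *)
Lemma chosen_exponential (C : category) (a b e p : C) (p1 : hom p e)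
    (p2 : hom p a) (ev : hom p b) :
  is_product p1 p2 ->
  (forall c : C, exists (s : C) (s1 : hom s c) (s2 : hom s a),
     is_product s1 s2 /\
     forall f : hom s b, exists! g : hom c e, exists h : hom s p,
       [/\ p1 \oc h = g \oc s1, p2 \oc h = s2 & ev \oc h = f]) ->
  is_exponential p1 p2 ev.
Proof.
move=> pP expc; split=> // c q q1 q2 qP f.
have [s [s1 [s2 [sP exps]]]] := expc c.
have [k [[k1 k2] _]] := qP _ s1 s2.
have [l [[l1 l2] _]] := sP _ q1 q2.
have kl : k \oc l = idm q.
  have [i [_ iU]] := qP _ q1 q2.
  rewrite -(iU (idm q)) ?comp_idr // -(iU (k \oc l)) //.
  by rewrite !Defs.compA k1 k2.
have [g [[h [h1 h2 h3]] gU]] := exps (f \oc k).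
exists g; split.
  exists (h \oc l); rewrite !Defs.compA h1 h2 h3 -!Defs.compA l1 l2 kl.
  by rewrite comp_idr.
move=> g' [h' [h1' h2' h3']]; apply: gU; exists (h' \oc k).
by rewrite !Defs.compA h1' h2' h3' -!Defs.compA k1 k2.
Qed.

(** * Forcing over a frame *)

Section Forcing.
Context {d : Order.disp_t} {Q : commQuantaleType d}.
Implicit Types (p q r s t : Q).

Definition qex (I : Type) (F : I -> Q) : Q := Sup (range F).
Definition qall (I : Type) (F : I -> Q) : Q := Sup (fun r => forall i, r <= F i).

Lemma le_byforce p q : (forall r, r <= p -> r <= q) -> p <= q.
Proof. exact. Qed.

Lemma forceI r p q : r <= p -> r <= q -> r <= p `&` q.
Proof. by rewrite lexI => -> ->. Qed.

Lemma forceI_inv r p q : r <= p `&` q -> r <= p /\ r <= q.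
Proof. by rewrite lexI => /andP. Qed.

Lemma force_ex (I : Type) (F : I -> Q) i r : r <= F i -> r <= qex F.
Proof. by move=> rF; apply: le_Sup rF _; exists i. Qed.

Lemma force_all (I : Type) (F : I -> Q) r : r <= qall F <-> forall i, r <= F i.
Proof.
split=> [rF i|]; last exact: Sup_ub.
by apply: le_trans rF _; apply: Sup_le => s; apply.
Qed.

Hypothesis Qfr : is_frame Q.

Lemma force_imp p q r : r <= p ~> q <-> forall s, s <= r -> s <= p -> s <= q.
Proof.
rewrite -residP Qfr; split=> [pr s sr sp|]; first by apply: le_trans pr; apply: forceI.
by apply; [apply: leIr | apply: leIl].
Qed.

(** The frame law: [r] is the supremum of the [r `&` F i], so it is enough to
    argue at each stage below [r] where a witness [i] exists. *)
Lemma force_ex_elim (I : Type) (F : I -> Q) r t :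
  r <= qex F -> (forall i s, s <= r -> s <= F i -> s <= t) -> r <= t.
Proof.
move=> rF h; have -> : r = r * qex F.
  by rewrite Qfr; apply/esym/meet_idPl.
rewrite qmulSup; apply: Sup_le => _ [_ [i _ <-] <-]; rewrite Qfr.
by apply: (h i); [apply: leIl | apply: leIr].
Qed.

End Forcing.

(** [pick H Qfr i Hi] eliminates [H : r <= qex F] in a goal [r <= t]: it passes to
    a smaller stage with a witness [i] and [Hi : r <= F i], and restricts all
    hypotheses forced at the old stage to the new one. *)
Ltac pick H Qfr i Hi :=
  let s := fresh "s" in let sr := fresh "sr" in
  refine (force_ex_elim Qfr H _); intros i s sr Hi;
  match type of sr with is_true (_ <= ?r) =>
    repeat match goal with
      K : is_true (@Order.le _ _ r _) |- _ => apply (le_trans sr) in K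
    end; clear sr; try clear H; try (clear r; rename s into r)
  end.

Section Frame.
Context {d : Order.disp_t} {Q : commQuantaleType d}.
Variables (Qdiv : divisible Q) (Qfr : is_frame Q).
Implicit Types (p q r s t : Q) (A B C X Y Z : qset Q).

Lemma force1 r : r <= 1.
Proof. exact: le_q1. Qed.

Lemma qeql X r (x y : X) : r <= qeq x y -> r <= qeq x x.
Proof. by move=> h; have /forceI_inv[] := le_trans h (qeq_extent x y). Qed.

Lemma qeqr X r (x y : X) : r <= qeq x y -> r <= qeq y y.
Proof. by rewrite qeq_sym; apply: qeql. Qed.

Lemma qeqC X r (x y : X) : r <= qeq x y -> r <= qeq y x.
Proof. by rewrite qeq_sym. Qed.

Lemma qeqT X r (x y z : X) : r <= qeq x y -> r <= qeq y z -> r <= qeq x z.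
Proof.
move=> xy yz; apply: le_trans (qeq_trans x y z); rewrite Qfr; apply: forceI => //.
by apply/(force_imp Qfr) => s sr _; apply: le_trans sr xy.
Qed.

(** Over a frame a [Q]-set is a symmetric and transitive [Q]-valued relation:
    the extents and the residual in the transitivity axiom take care of
    themselves. *)
Section MkQset.
Variables (T : Type) (e : T -> T -> Q).
Hypothesis sym : forall r x y, r <= e x y -> r <= e y x.
Hypothesis trans : forall r x y z, r <= e x y -> r <= e y z -> r <= e x z.

Lemma mk_qset_sym x y : e x y = e y x.
Proof. by apply/le_anti/andP; split; apply: sym. Qed.

Lemma mk_qset_extent x y : e x y <= e x x `&` e y y.
Proof. by apply: forceI; apply: trans (sym _) => //; exact: sym. Qed.

Lemma mk_qset_trans x y z : e y z * (e y y ~> e x y) <= e x z.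
Proof.
apply: le_byforce => r; rewrite Qfr => /forceI_inv[yz /(force_imp Qfr) xy].
apply: trans (yz); apply: xy => //.
by have /forceI_inv[] := le_trans yz (mk_qset_extent y z).
Qed.

Definition mk_qset : qset Q := QSet mk_qset_extent mk_qset_sym mk_qset_trans.

End MkQset.

(** * Functional relations *)

Section Functional.
Variables A B : qset Q.
Implicit Types (phi : A -> B -> Q).

(** The truth value of the statement that [phi] is a functional relation: strict,
    extensional, single-valued and total. A truth value is needed, and not only
    a proposition, because it is the extent of [phi] in the exponential. *)
Definition isfun phi : Q :=
  qall (fun x => qall (fun y => phi x y ~> qeq x x `&` qeq y y)) `&`
  (qall (fun x => qall (fun x' => qall (fun y => qall (fun y' =>
    phi x y `&` (qeq x x' `&` qeq y y') ~> phi x' y')))) `&`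
  (qall (fun x => qall (fun y => qall (fun y' =>
    phi x y `&` phi x y' ~> qeq y y'))) `&`
  qall (fun x => qeq x x ~> qex (phi x)))).

Lemma isfunI r phi :
  (forall s x y, s <= r -> s <= phi x y -> s <= qeq x x /\ s <= qeq y y) ->
  (forall s x x' y y', s <= r -> s <= phi x y -> s <= qeq x x' ->
     s <= qeq y y' -> s <= phi x' y') ->
  (forall s x y y', s <= r -> s <= phi x y -> s <= phi x y' -> s <= qeq y y') ->
  (forall s x, s <= r -> s <= qeq x x -> s <= qex (phi x)) ->
  r <= isfun phi.
Proof.
move=> h1 h2 h3 h4; apply: forceI; last apply: forceI; last apply: forceI.
- do 2![apply/force_all => ?]; apply/(force_imp Qfr) => s sr /(h1 s _ _ sr)[].
  exact: forceI.
- do 4![apply/force_all => ?]; apply/(force_imp Qfr) => s sr.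
  by case/forceI_inv => ? /forceI_inv[]; apply: h2 sr _.
- do 3![apply/force_all => ?]; apply/(force_imp Qfr) => s sr /forceI_inv[].
  exact: h3.
- by apply/force_all => ?; apply/(force_imp Qfr) => s; apply: h4.
Qed.

Section Elim.
Variables (r : Q) (phi : A -> B -> Q).
Hypothesis phiF : r <= isfun phi.

Lemma isfun_strict x y : r <= phi x y -> r <= qeq x x /\ r <= qeq y y.
Proof.
move/forceI_inv: phiF => [/force_all/(_ x)/force_all/(_ y)/(force_imp Qfr) h _].
by move/(h _ (lexx r))/forceI_inv.
Qed.

Lemma isfun_ext x x' y y' :
  r <= phi x y -> r <= qeq x x' -> r <= qeq y y' -> r <= phi x' y'.
Proof.
move/forceI_inv: phiF => [_ /forceI_inv[+ _]].
move=> /force_all/(_ x)/force_all/(_ x')/force_all/(_ y)/force_all/(_ y').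
move=> /(force_imp Qfr) h ? ? ?; apply: h => //; by do 2?apply: forceI.
Qed.

Lemma isfun_sv x y y' : r <= phi x y -> r <= phi x y' -> r <= qeq y y'.
Proof.
move/forceI_inv: phiF => [_ /forceI_inv[_ /forceI_inv[+ _]]].
move=> /force_all/(_ x)/force_all/(_ y)/force_all/(_ y').
by move=> /(force_imp Qfr) h ? ?; apply: h => //; apply: forceI.
Qed.

Lemma isfun_total x : r <= qeq x x -> r <= qex (phi x).
Proof.
move/forceI_inv: phiF => [_ /forceI_inv[_ /forceI_inv[_ +]]].
by move=> /force_all/(_ x)/(force_imp Qfr); apply.
Qed.

End Elim.
End Functional.

Lemma force_dcomp X Y Z (psi : Y -> Z -> Q) (phi : X -> Y -> Q) r x y z :
  r <= phi x y -> r <= psi y z -> r <= dcomp psi phi x z.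
Proof.
move=> xy yz; apply: le_trans (dcomp_ub _ _ _ y _); rewrite Qfr.
by apply: forceI => //; apply/(force_imp Qfr) => s sr _; apply: le_trans sr xy.
Qed.

Lemma force_dcomp_inv X Y Z (psi : Y -> Z -> Q) (phi : X -> Y -> Q) r x z :
  distributor psi ->
  r <= dcomp psi phi x z -> r <= qex (fun y => phi x y `&` psi y z).
Proof.
move=> dpsi rc; pick rc Qfr y h; move: h; rewrite Qfr.
case/forceI_inv => yz /(force_imp Qfr) xy; apply: (force_ex (i := y)); apply: forceI => //.
by apply: xy => //; apply: le_trans yz (dist_extl _ _ dpsi).
Qed.

Lemma functional_distributor X Y (phi : X -> Y -> Q) :
  1 <= isfun phi -> distributor phi.
Proof.
move=> F1; have F r : r <= isfun phi by apply: le_trans F1; apply: force1.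
split=> [x y|x y y'|x x' y]; apply: le_byforce => r.
- by case/(isfun_strict (F r)); apply: forceI.
- rewrite Qfr => /forceI_inv[yy' /(force_imp Qfr)/(_ _ (lexx r) (qeql yy')) xy].
  have [xx _] := isfun_strict (F r) xy; exact: (isfun_ext (F r) xy xx yy').
- rewrite Qfr => /forceI_inv[xy]; have [xx yy] := isfun_strict (F r) xy.
  move=> /(force_imp Qfr)/(_ _ (lexx r) xx)/qeqC x'x.
  exact: (isfun_ext (F r) xy x'x yy).
Qed.

Lemma distributor_ext X Y (phi : X -> Y -> Q) r x x' y y' :
  distributor phi ->
  r <= phi x y -> r <= qeq x x' -> r <= qeq y y' -> r <= phi x' y'.
Proof.
move=> dphi xy xx' yy'.
have x'y : r <= phi x' y.
  apply: le_trans (dist_left dphi x x' y); rewrite Qfr; apply: forceI => //.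
  by apply/(force_imp Qfr) => s sr _; apply: le_trans sr (qeqC xx').
apply: le_trans (dist_right dphi x' y y'); rewrite Qfr; apply: forceI => //.
by apply/(force_imp Qfr) => s sr _; apply: le_trans sr x'y.
Qed.

(** The unit is totality. For single-valuedness, totality gives [y0] with
    [psi y0 x], and the counit identifies with [y0] every [y] such that
    [phi x y]. Conversely the right adjoint of a functional relation is its
    opposite relation. *)
Lemma left_adjointP X Y (phi : X -> Y -> Q) : left_adjoint phi <-> 1 <= isfun phi.
Proof.
split=> [[dphi [psi [dpsi u c]]]|F1].
  apply: isfunI.
  - by move=> r x y _ xy; have /forceI_inv := le_trans xy (dist_extent dphi x y).
  - by move=> r x x' y y' _; apply: distributor_ext.
  - move=> r x y y' _ xy xy'.
    have := le_trans (le_trans xy (dist_extl x y dphi)) (u x x).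
    move=> /(force_dcomp_inv dpsi) e; pick e Qfr y0 h.
    case/forceI_inv: h => _ y0x.
    have cr v : r <= phi x v -> r <= qeq y0 v.
      by move=> xv; apply: le_trans (c _ _); apply: force_dcomp xv.
    by apply: qeqT (qeqC (cr _ xy)) (cr _ xy').
  - move=> r x _ xx; have := le_trans xx (u x x).
    move=> /(force_dcomp_inv dpsi) e; pick e Qfr y h.
    by case/forceI_inv: h => xy _; apply: force_ex xy.
have F r : r <= isfun phi by apply: le_trans F1; apply: force1.
have dphi := functional_distributor F1.
split=> //; exists (fun y x => phi x y); split.
- split=> [y x|y x x'|y y' x]; apply: le_byforce => r.
  + by case/(isfun_strict (F r)) => ? ?; apply: forceI.
  + rewrite Qfr => /forceI_inv[xx' /(force_imp Qfr)/(_ _ (lexx r) (qeql xx')) xy].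
    by have [_ yy] := isfun_strict (F r) xy; apply: (isfun_ext (F r) xy xx' yy).
  + rewrite Qfr => /forceI_inv[xy]; have [xx yy] := isfun_strict (F r) xy.
    move=> /(force_imp Qfr)/(_ _ (lexx r) yy)/qeqC y'y.
    exact: (isfun_ext (F r) xy xx y'y).
- move=> x x'; apply: le_byforce => r xx'.
  have e := isfun_total (F r) (qeql xx'); pick e Qfr y xy.
  have [_ yy] := isfun_strict (F _) xy.
  exact: force_dcomp xy (isfun_ext (F _) xy xx' yy).
- move=> y y'; apply: le_byforce => r /(force_dcomp_inv dphi) e.
  pick e Qfr x h; case/forceI_inv: h => xy xy'; exact: (isfun_sv (F _) xy xy').
Qed.

Definition fun_hom X Y (phi : X -> Y -> Q) (F : 1 <= isfun phi) : qhom X Y :=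
  QHom (iffRL (left_adjointP phi) F).

Section Homs.
Variables (X Y : qset Q) (f : qhom X Y).

Lemma hom_isfun r : r <= isfun f.
Proof. by apply: le_trans (force1 r) _; apply/left_adjointP/qdist_adjoint. Qed.

Lemma hom_dom r x y : r <= f x y -> r <= qeq x x.
Proof. by case/(isfun_strict (hom_isfun r)). Qed.

Lemma hom_cod r x y : r <= f x y -> r <= qeq y y.
Proof. by case/(isfun_strict (hom_isfun r)). Qed.

Lemma hom_ext r x x' y y' :
  r <= f x y -> r <= qeq x x' -> r <= qeq y y' -> r <= f x' y'.
Proof. exact: (isfun_ext (hom_isfun r)). Qed.

Lemma hom_extl r x x' y : r <= f x y -> r <= qeq x x' -> r <= f x' y.
Proof. by move=> xy xx'; apply: (hom_ext xy xx' (hom_cod xy)). Qed.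

Lemma hom_extr r x y y' : r <= f x y -> r <= qeq y y' -> r <= f x y'.
Proof. by move=> xy; apply: (hom_ext xy (hom_dom xy)). Qed.

Lemma hom_sv r x y y' : r <= f x y -> r <= f x y' -> r <= qeq y y'.
Proof. exact: (isfun_sv (hom_isfun r)). Qed.

Lemma hom_total r x : r <= qeq x x -> r <= qex (f x).
Proof. exact: (isfun_total (hom_isfun r)). Qed.

End Homs.

(** Functional relations are total and single-valued, so an inclusion between two
    of them is an equality. *)
Lemma hom_le_eq X Y (f g : qhom X Y) :
  (forall r x y, r <= f x y -> r <= g x y) -> f = g.
Proof.
move=> fg; apply: qhom_eq => x y; apply/le_anti/andP; split.
  by apply: le_byforce => r; apply: fg.
apply: le_byforce => r gxy.
have e := hom_total f (hom_dom gxy); pick e Qfr y' fxy'.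
exact: (hom_extr fxy' (hom_sv (fg _ _ _ fxy') gxy)).
Qed.

Notation "g \oq f" := (qhom_comp Qdiv g f) (at level 50, left associativity).

(** Composition is relational composition; the lemmas below are its introduction
    and elimination rules, for triangles and for squares. *)
Lemma comp_eq X Y Z (f : qhom X Y) (g : qhom Y Z) (h : qhom X Z) :
  (forall r x y z, r <= f x y -> r <= g y z -> r <= h x z) -> g \oq f = h.
Proof.
move=> fgh; apply: hom_le_eq => r x z /(force_dcomp_inv (qhom_dist g)) e.
by pick e Qfr y k; case/forceI_inv: k; apply: fgh.
Qed.

Lemma comp_in X Y Z (f : qhom X Y) (g : qhom Y Z) (h : qhom X Z) r x y z :
  g \oq f = h -> r <= f x y -> r <= g y z -> r <= h x z.
Proof. by move=> <-; apply: force_dcomp. Qed.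

Lemma comp_out X Y Z (f : qhom X Y) (g : qhom Y Z) (h : qhom X Z) r x z :
  g \oq f = h -> r <= h x z -> r <= qex (fun y => f x y `&` g y z).
Proof. by move=> <-; apply: force_dcomp_inv; apply: qhom_dist. Qed.

Lemma square_eq X Y Y' Z (f : qhom X Y) (g : qhom Y Z) (f' : qhom X Y')
    (g' : qhom Y' Z) :
  (forall r x y z, r <= f x y -> r <= g y z ->
     r <= qex (fun y' => f' x y' `&` g' y' z)) -> g \oq f = g' \oq f'.
Proof.
move=> fg; apply: comp_eq => r x y z xy yz; have e := fg _ _ _ _ xy yz.
by pick e Qfr y' k; case/forceI_inv: k; apply: force_dcomp.
Qed.

Lemma square_inv X Y Y' Z (f : qhom X Y) (g : qhom Y Z) (f' : qhom X Y')
    (g' : qhom Y' Z) r x y z :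
  g \oq f = g' \oq f' -> r <= f x y -> r <= g y z ->
  r <= qex (fun y' => f' x y' `&` g' y' z).
Proof.
by move=> e xy yz; apply: comp_out erefl _; apply: comp_in e xy yz.
Qed.


(** * Terminal object *)

Definition one_qset : qset Q :=
  @mk_qset unit (fun _ _ => 1) (fun _ _ _ h => h) (fun _ _ _ _ h _ => h).

Lemma to_one_isfun X : 1 <= isfun (fun (x : X) (_ : one_qset) => qeq x x).
Proof.
apply: isfunI => [s x y _ xx|s x x' y y' _ _ xx' _|s *|s x _ xx].
- by split=> //; apply: force1.
- exact: qeqr xx'.
- exact: force1.
- exact: (force_ex (i := tt)).
Qed.

Definition to_one X : qhom X one_qset := fun_hom (to_one_isfun X).

Lemma to_one_unique X (f : qhom X one_qset) : f = to_one X.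
Proof. by apply: hom_le_eq => r x y; apply: hom_dom. Qed.

Lemma one_terminal : @is_terminal (QSetCat Qdiv) one_qset.
Proof. by move=> X; exists (to_one X); split=> // f _; rewrite [RHS]to_one_unique. Qed.

(** * Products and pullbacks *)

(** The part of [A * B] cut out by an extensional relation [S]. The full relation
    gives products, and [f a = g b] gives pullbacks. *)
Section SubProduct.
Variables (A B : qset Q) (S : A -> B -> Q).
Hypothesis S_ext : forall r a a' b b',
  r <= S a b -> r <= qeq a a' -> r <= qeq b b' -> r <= S a' b'.

Definition sprod_eq (u v : A * B) : Q :=
  qeq u.1 v.1 `&` (qeq u.2 v.2 `&` S u.1 u.2).

Lemma sprod_eqP r u v :
  r <= sprod_eq u v <-> [/\ r <= qeq u.1 v.1, r <= qeq u.2 v.2 & r <= S u.1 u.2].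
Proof.
split=> [/forceI_inv[? /forceI_inv[]] //|[? ? ?]].
by do 2?apply: forceI.
Qed.

Definition sprod : qset Q.
Proof.
apply: (@mk_qset (A * B) sprod_eq) => [r u v|r u v w].
  move=> /sprod_eqP[h1 h2 hS]; apply/sprod_eqP; split; try exact: qeqC.
  exact: S_ext hS h1 h2.
move=> /sprod_eqP[h1 h2 hS] /sprod_eqP[h1' h2' _]; apply/sprod_eqP; split=> //.
  exact: qeqT h1 h1'.
exact: qeqT h2 h2'.
Defined.

Lemma sprod_fst_isfun :
  1 <= isfun (fun (u : sprod) (a : A) => sprod_eq u u `&` qeq u.1 a).
Proof.
apply: isfunI => [s u a _|s u v a b _|s u a b _|s u _].
- by case/forceI_inv => uu ua; split=> //; apply: qeqr ua.
- case/forceI_inv => uu ua uv ab; apply: forceI; first exact: qeqr uv.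
  have /sprod_eqP[uv1 _ _] := uv; exact: qeqT (qeqC uv1) (qeqT ua ab).
- by case/forceI_inv => _ ua /forceI_inv[_ ub]; apply: qeqT (qeqC ua) ub.
- move=> uu; apply: (force_ex (i := u.1)); apply: forceI => //.
  by have /sprod_eqP[] := uu.
Qed.

Lemma sprod_snd_isfun :
  1 <= isfun (fun (u : sprod) (b : B) => sprod_eq u u `&` qeq u.2 b).
Proof.
apply: isfunI => [s u a _|s u v a b _|s u a b _|s u _].
- by case/forceI_inv => uu ua; split=> //; apply: qeqr ua.
- case/forceI_inv => uu ua uv ab; apply: forceI; first exact: qeqr uv.
  have /sprod_eqP[_ uv2 _] := uv; exact: qeqT (qeqC uv2) (qeqT ua ab).
- by case/forceI_inv => _ ua /forceI_inv[_ ub]; apply: qeqT (qeqC ua) ub.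
- move=> uu; apply: (force_ex (i := u.2)); apply: forceI => //.
  by have /sprod_eqP[] := uu.
Qed.

Definition sprod_fst : qhom sprod A := fun_hom sprod_fst_isfun.
Definition sprod_snd : qhom sprod B := fun_hom sprod_snd_isfun.

Section Pairing.
Variables (Z : qset Q) (f : qhom Z A) (g : qhom Z B).
Hypothesis fgS : forall r z a b, r <= f z a -> r <= g z b -> r <= S a b.

Lemma spair_isfun : 1 <= isfun (fun z (u : sprod) => f z u.1 `&` g z u.2).
Proof.
apply: isfunI => [s z u _|s z z' u v _|s z u v _|s z _].
- case/forceI_inv => fu gu; split; first exact: hom_dom fu.
  by apply/sprod_eqP; split; [exact: hom_cod fu | exact: hom_cod gu | exact: fgS fu gu].
- case/forceI_inv => fu gu zz' /sprod_eqP[uv1 uv2 _].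
  by apply: forceI; [exact: hom_ext fu zz' uv1 | exact: hom_ext gu zz' uv2].
- case/forceI_inv => fu gu /forceI_inv[fv gv]; apply/sprod_eqP.
  by split; [exact: hom_sv fu fv | exact: hom_sv gu gv | exact: fgS fu gu].
- move=> zz; have e := hom_total f zz; pick e Qfr a fa.
  have e := hom_total g zz; pick e Qfr b gb.
  by apply: (force_ex (i := (a, b))); apply: forceI.
Qed.

Definition spair : qhom Z sprod := fun_hom spair_isfun.

Lemma spair_fst : sprod_fst \oq spair = f.
Proof.
apply: comp_eq => r z u a /forceI_inv[fu _] /forceI_inv[_ ua].
exact: (hom_extr fu ua).
Qed.

Lemma spair_snd : sprod_snd \oq spair = g.
Proof.
apply: comp_eq => r z u b /forceI_inv[_ gu] /forceI_inv[_ ub].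
exact: (hom_extr gu ub).
Qed.

Lemma spair_unique (h : qhom Z sprod) :
  sprod_fst \oq h = f -> sprod_snd \oq h = g -> h = spair.
Proof.
move=> hf hg; apply: hom_le_eq => r z u zu; have uu := hom_cod zu.
have /sprod_eqP[u1 u2 _] := uu.
by apply: forceI; [apply: (comp_in hf zu) | apply: (comp_in hg zu)]; apply: forceI.
Qed.

End Pairing.
End SubProduct.

Section Product.
Variables A B : qset Q.

Lemma top_ext r (a a' : A) (b b' : B) :
  r <= 1 -> r <= qeq a a' -> r <= qeq b b' -> r <= 1.
Proof. by []. Qed.

Definition prodq : qset Q := sprod top_ext.

Lemma prodq_pairing Z (f : qhom Z A) (g : qhom Z B) :
  exists! h : qhom Z prodq,
    sprod_fst top_ext \oq h = f /\ sprod_snd top_ext \oq h = g.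
Proof.
have fg1 r z a b : r <= f z a -> r <= g z b -> r <= 1 by move=> *; apply: force1.
exists (spair top_ext fg1); split; first by split; [exact: spair_fst | exact: spair_snd].
by move=> h [hf hg]; rewrite (spair_unique fg1 hf hg).
Qed.

Lemma prodq_product :
  @is_product (QSetCat Qdiv) _ _ _ (sprod_fst top_ext) (sprod_snd top_ext).
Proof. exact: prodq_pairing. Qed.

End Product.

Section Pullback.
Variables (A B C : qset Q) (f : qhom A C) (g : qhom B C).

(** The truth value of [f a = g b]. *)
Definition pb_rel a b : Q := qex (fun c => f a c `&` g b c).

Lemma pb_rel_ext r a a' b b' :
  r <= pb_rel a b -> r <= qeq a a' -> r <= qeq b b' -> r <= pb_rel a' b'.
Proof.
move=> e aa' bb'; pick e Qfr c h; case/forceI_inv: h => fc gc.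
apply: (force_ex (i := c)); apply: forceI.
  exact: (hom_extl fc aa').
exact: (hom_extl gc bb').
Qed.

Lemma sprod_pullback :
  @is_pullback (QSetCat Qdiv) _ _ _ f g _
    (sprod_fst pb_rel_ext) (sprod_snd pb_rel_ext).
Proof.
split.
  apply: square_eq => r u a c /forceI_inv[uu ua] ac.
  have /sprod_eqP[_ u2 e] := uu; pick e Qfr c' h; case/forceI_inv: h => fc gc.
  apply: (force_ex (i := u.2)); apply: forceI; first exact: forceI.
  exact: (hom_extr gc (hom_sv (hom_extl fc ua) ac)).
move=> Z q1 q2 e.
have S12 r z a b : r <= q1 z a -> r <= q2 z b -> r <= pb_rel a b.
  move=> za zb; have t := hom_total f (hom_cod za); pick t Qfr c ac.
  have k := square_inv e za ac; pick k Qfr b' h; case/forceI_inv: h => zb' b'c.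
  apply: (force_ex (i := c)); apply: forceI => //.
  exact: (hom_extl b'c (hom_sv zb' zb)).
exists (spair pb_rel_ext S12); split; first by split; [exact: spair_fst | exact: spair_snd].
by move=> h [hf hg]; rewrite (spair_unique S12 hf hg).
Qed.

End Pullback.

(** * Subobject classifier *)

Definition qiff (p q : Q) : Q := (p ~> q) `&` (q ~> p).

Lemma force_iff r p q :
  r <= qiff p q <-> forall s, s <= r -> (s <= p <-> s <= q).
Proof.
split=> [/forceI_inv[/(force_imp Qfr) pq /(force_imp Qfr) qp] s sr|h].
  by split; [apply: pq | apply: qp].
by apply: forceI; apply/(force_imp Qfr) => s sr; apply h.
Qed.

Definition omega : qset Q.
Proof.
apply: (@mk_qset Q qiff) => [r p q /force_iff h|r p q t /force_iff h /force_iff k].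
  by apply/force_iff => s sr; split; apply h.
by apply/force_iff => s sr; split=> [/(h s sr)/(k s sr)|/(k s sr)/(h s sr)].
Defined.

Lemma omega_refl r (p : omega) : r <= qeq p p.
Proof. by apply/force_iff. Qed.

Lemma true_isfun : 1 <= isfun (fun (_ : one_qset) (p : omega) => p : Q).
Proof.
apply: isfunI => [s x p _ _|s _ _ p q _ sp _ /force_iff pq|s _ p q _ sp sq|s _ _ _].
- by split; [apply: force1 | apply: omega_refl].
- by apply/(pq s (lexx s)).
- by apply/force_iff => t ts; split=> _; apply: le_trans ts _.
- by apply: (force_ex (i := 1)); apply: force1.
Qed.

Definition true_hom : qhom one_qset omega := fun_hom true_isfun.

Section Classify.
Variables (A B : qset Q) (m : qhom A B).

(** The two projections of the kernel pair of a mono agree; the extent of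
    [(a, a')] in it is the degree to which [a] and [a'] have the same image. *)
Lemma mono_injective : @mono (QSetCat Qdiv) _ _ m ->
  forall r a a' b, r <= m a b -> r <= m a' b -> r <= qeq a a'.
Proof.
move=> mm r a a' b ab a'b.
have [sq _] := sprod_pullback m m.
have e := mm _ _ _ sq.
have h : r <= sprod_fst (pb_rel_ext (f := m) (g := m)) (a, a') a.
  have aa := hom_dom ab; apply: forceI => //; apply/sprod_eqP; split=> //.
    exact: hom_dom a'b.
  by apply: (force_ex (i := b)); apply: forceI.
by rewrite e in h; case/forceI_inv: h => _; apply: qeqC.
Qed.

(** The truth value of [b] being in the image of [m]; it is the value at [b] of the
    characteristic map. *)
Definition img b : Q := qex (fun a => m a b).

Lemma img_ext r b b' : r <= img b -> r <= qeq b b' -> r <= img b'.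
Proof.
move=> e bb'; pick e Qfr a ab; apply: (force_ex (i := a)); exact: (hom_extr ab bb').
Qed.

Lemma chi_isfun : 1 <= isfun (fun (b : B) (p : omega) => qeq b b `&` qiff (img b) p).
Proof.
apply: isfunI => [s b p _|s b b' p q _|s b p q _|s b _].
- by case/forceI_inv => bb _; split=> //; apply: omega_refl.
- case/forceI_inv => bb /force_iff bp bb' /force_iff pq.
  apply: forceI; first exact: qeqr bb'.
  apply/force_iff => t ts; have tb := le_trans ts bb'; split=> [ib|iq].
    by apply/(pq _ ts)/(bp _ ts)/(img_ext ib)/qeqC.
  by apply: img_ext tb; apply/(bp _ ts)/(pq _ ts).
- case/forceI_inv => _ /force_iff bp /forceI_inv[_ /force_iff bq].
  by apply/force_iff => t ts; split=> [/(bp t ts)/(bq t ts)|/(bq t ts)/(bp t ts)].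
- move=> bb; apply: (force_ex (i := img b)); apply: forceI => //.
  exact: omega_refl.
Qed.

Definition chi : qhom B omega := fun_hom chi_isfun.

(** A map [f] into [B] on which [chi] is true has values in the image of [m]; as [m]
    is injective, composing [f] with the opposite of [m] is functional. *)
Lemma chi_pullback : @mono (QSetCat Qdiv) _ _ m ->
  @is_pullback (QSetCat Qdiv) _ _ _ chi true_hom _ m (to_one A).
Proof.
move=> mm; have inj := mono_injective mm; split.
  apply: square_eq => r a b p ab /forceI_inv[bb /force_iff bp].
  apply: (force_ex (i := tt)); apply: forceI; first exact: hom_dom ab.
  by apply/(bp _ (lexx r)); apply: (force_ex (i := a)).
move=> Z f u e.
have f_img r z b : r <= f z b -> r <= img b.
  move=> zb; have bb := hom_cod zb.
  have k : r <= chi b (img b) by apply: forceI => //; apply: omega_refl.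
  by have k' := square_inv e zb k; pick k' Qfr x h; case/forceI_inv: h.
have hF : 1 <= isfun (fun z a => qex (fun b => f z b `&` m a b)).
  apply: isfunI => [s z a _|s z z' a a' _|s z a a' _|s z _].
  - move=> k; split; pick k Qfr b h; case/forceI_inv: h => zb ab.
      exact: hom_dom zb.
    exact: hom_dom ab.
  - move=> k zz' aa'; pick k Qfr b h; case/forceI_inv: h => zb ab.
    apply: (force_ex (i := b)); apply: forceI.
      exact: (hom_extl zb zz').
    exact: (hom_extl ab aa').
  - move=> k k'; pick k Qfr b h; case/forceI_inv: h => zb ab.
    pick k' Qfr b' h; case/forceI_inv: h => zb' ab'.
    exact: (inj _ _ _ _ ab (hom_extr ab' (hom_sv zb' zb))).
  - move=> zz; have k := hom_total f zz; pick k Qfr b zb.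
    have k := f_img _ _ _ zb; pick k Qfr a ab.
    by apply: (force_ex (i := a)); apply: (force_ex (i := b)); apply: forceI.
exists (fun_hom hF); split.
  split; last by rewrite [RHS]to_one_unique [LHS]to_one_unique.
  apply: comp_eq => r z a b k ab; pick k Qfr b' h; case/forceI_inv: h => zb' ab'.
  exact: (hom_extr zb' (hom_sv ab' ab)).
move=> h [mh _]; apply/esym/hom_le_eq => r z a za.
have k := hom_total m (hom_cod za); pick k Qfr b ab.
apply: (force_ex (i := b)); apply: forceI => //; exact: (comp_in mh za ab).
Qed.

(** At [b] the value [p] of another such [c] must be equivalent to [img b]. The
    image satisfies [c] because the square commutes; conversely, where [p] holds,
    the universal property applied to [b] as a generalized element lifts
    [b] along [m]. *)
Lemma chi_unique (c : qhom B omega) (u : qhom A one_qset) :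
  @is_pullback (QSetCat Qdiv) _ _ _ c true_hom _ m u -> c = chi.
Proof.
move=> [sq univ]; apply: hom_le_eq => r b p bp; apply: forceI; first exact: hom_dom bp.
apply/force_iff => s sr; have {}bp := le_trans sr bp; split=> [k|sp].
  pick k Qfr a ab; have k := square_inv sq ab bp.
  by pick k Qfr x h; case/forceI_inv: h.
(* the part of [b] at stage [s], as a one-point set mapping to [B] *)
have pt_sym t (x y : unit) : t <= s -> t <= s by [].
have pt_trans t (x y z : unit) : t <= s -> t <= s -> t <= s by [].
pose pt : qset Q := mk_qset pt_sym pt_trans.
have ptF : 1 <= isfun (fun (_ : pt) b' => s `&` qeq b b').
  apply: isfunI => [t x b' _|t x y b1 b2 _|t x b1 b2 _|t x _].
  - by case/forceI_inv => ts bb'; split=> //; exact: qeqr bb'.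
  - by case/forceI_inv => ts bb1 _ b12; apply: forceI => //; exact: qeqT bb1 b12.
  - by case/forceI_inv => _ bb1 /forceI_inv[_]; apply: qeqT (qeqC bb1).
  - move=> ts; apply: (force_ex (i := b)); apply: forceI => //.
    by apply: le_trans ts _; exact: hom_dom bp.
have [|h [[mh _] _]] := univ pt (fun_hom ptF) (to_one pt).
  apply: square_eq => t x b' q /forceI_inv[ts bb'] b'q.
  apply: (force_ex (i := tt)); apply: forceI => //.
  have {}b'q := hom_extl b'q (qeqC bb').
  have /force_iff k := hom_sv (le_trans ts bp) b'q.
  by apply/(k _ (lexx t)); apply: le_trans ts sp.
have k : s <= fun_hom ptF tt b by apply: forceI => //; exact: hom_dom bp.
have := comp_out mh k => {}k; pick k Qfr a l; case/forceI_inv: l => _ ab.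
by apply: (force_ex (i := a)).
Qed.

End Classify.

Lemma omega_classifier : @is_subobject_classifier (QSetCat Qdiv) _ _ true_hom.
Proof.
split; first exact: one_terminal.
move=> A B m mm; exists (chi m); split.
  by exists (to_one A); apply: chi_pullback.
by move=> c [u pb]; rewrite (chi_unique pb).
Qed.

(** * Exponentials *)

Section Exponential.
Variables A B : qset Q.

Definition exp_eq (phi psi : A -> B -> Q) : Q :=
  isfun phi `&` (isfun psi `&`
    qall (fun x => qall (fun y => qiff (phi x y) (psi x y)))).

Lemma exp_eqP r phi psi : r <= exp_eq phi psi <->
  [/\ r <= isfun phi, r <= isfun psi
    & forall s x y, s <= r -> (s <= phi x y <-> s <= psi x y)].
Proof.
split=> [/forceI_inv[? /forceI_inv[? /force_all h]]|[h1 h2 h3]].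
  by split=> // s x y; move: (h x) => /force_all/(_ y)/force_iff; apply.
do 2!apply: forceI => //; do 2!apply/force_all => ?.
by apply/force_iff => s; apply: h3.
Qed.

Definition expq : qset Q.
Proof.
apply: (@mk_qset (A -> B -> Q) exp_eq) => [r f g /exp_eqP[h1 h2 h3]|r f g h].
  by apply/exp_eqP; split=> // s x y sr; split; apply h3.
move=> /exp_eqP[h1 h2 h3] /exp_eqP[_ k2 k3]; apply/exp_eqP; split=> // s x y sr.
by split=> [/(h3 s _ _ sr)/(k3 s _ _ sr)|/(k3 s _ _ sr)/(h3 s _ _ sr)].
Defined.

Lemma exp_extent r phi : r <= isfun phi -> r <= exp_eq phi phi.
Proof. by move=> h; apply/exp_eqP. Qed.

Local Notation EA := (prodq expq A).
Local Notation prod_fst := (sprod_fst (@top_ext _ _)).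
Local Notation prod_snd := (sprod_snd (@top_ext _ _)).

Lemma prod_extent (X Y : qset Q) r (x : X) (y : Y) :
  r <= qeq x x -> r <= qeq y y -> r <= qeq ((x, y) : prodq X Y) (x, y).
Proof. by move=> ? ?; apply/sprod_eqP; split=> //; apply: force1. Qed.

Lemma ev_isfun : 1 <= isfun (fun (u : EA) y => isfun u.1 `&` u.1 u.2 y).
Proof.
apply: isfunI => [s u y _|s u v y y' _|s u y y' _|s u _].
- case/forceI_inv => F uy; have [xx yy] := isfun_strict F uy; split=> //.
  by apply/sprod_eqP; split=> //; [exact: exp_extent | exact: force1].
- case/forceI_inv => F uy /sprod_eqP[/exp_eqP[_ G uv] xx' _] yy'.
  apply: forceI => //; apply: (isfun_ext G) xx' yy'.
  by apply/(uv s _ _ (lexx s)).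
- by case/forceI_inv => F uy /forceI_inv[_ uy']; exact: (isfun_sv F uy uy').
- case/sprod_eqP => /exp_eqP[F _ _] xx _; have e := isfun_total F xx.
  by pick e Qfr y xy; apply: (force_ex (i := y)); apply: forceI.
Qed.

Definition ev : qhom EA B := fun_hom ev_isfun.

Section Transpose.
Variables (C : qset Q) (f : qhom (prodq C A) B).

Definition curry_rel (c : C) (phi : expq) : Q :=
  qeq c c `&` (isfun phi `&`
    qall (fun x => qall (fun y => qiff (phi x y) (f (c, x) y)))).

Lemma curry_relP r c phi : r <= curry_rel c phi <->
  [/\ r <= qeq c c, r <= isfun phi
    & forall s x y, s <= r -> (s <= phi x y <-> s <= f (c, x) y)].
Proof.
split=> [/forceI_inv[? /forceI_inv[? /force_all h]]|[h1 h2 h3]].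
  by split=> // s x y; move: (h x) => /force_all/(_ y)/force_iff; apply.
do 2!apply: forceI => //; do 2!apply/force_all => ?.
by apply/force_iff => s; apply: h3.
Qed.

Lemma f_extl r c c' x y : r <= f (c, x) y -> r <= qeq c c' -> r <= f (c', x) y.
Proof.
move=> h cc'; apply: (hom_extl h); have /sprod_eqP[_ xx _] := hom_dom h.
by apply/sprod_eqP; split=> //; exact: force1.
Qed.

Lemma curry_isfun : 1 <= isfun curry_rel.
Proof.
apply: isfunI => [s c phi _|s c c' phi psi _|s c phi psi _|s c _].
- by case/curry_relP => cc F _; split=> //; apply: exp_extent.
- case/curry_relP => cc F h cc' /exp_eqP[_ G k]; apply/curry_relP; split=> //.
    exact: qeqr cc'.
  move=> t x y ts; have tc := le_trans ts cc'; split=> [xy|cxy].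
    by apply: f_extl tc; apply/(h t _ _ ts)/(k t _ _ ts).
  by apply/(k t _ _ ts)/(h t _ _ ts)/(f_extl cxy)/qeqC.
- case/curry_relP => cc F h /curry_relP[_ G k]; apply/exp_eqP; split=> // t x y ts.
  by split=> [/(h t _ _ ts)/(k t _ _ ts)|/(k t _ _ ts)/(h t _ _ ts)].
- move=> cc; apply: (force_ex (i := fun x y => f (c, x) y)).
  apply/curry_relP; split=> //.
  apply: isfunI => [t x y ts xy|t x x' y y' ts xy xx' yy'|t x y y' ts|t x ts xx].
  + have /sprod_eqP[_ xx _] := hom_dom xy; split=> //; exact: hom_cod xy.
  + apply: (hom_ext xy) yy'; apply/sprod_eqP; split=> //; last exact: force1.
    exact: le_trans ts cc.
  + exact: hom_sv.
  + by apply/hom_total/prod_extent => //; apply: le_trans ts cc.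
Qed.

Definition curry : qhom C expq := fun_hom curry_isfun.

Lemma curry_ev : exists h : qhom (prodq C A) EA,
  [/\ prod_fst \oq h = curry \oq prod_fst, prod_snd \oq h = prod_snd
    & ev \oq h = f].
Proof.
have [h [[h1 h2] _]] := prodq_pairing (curry \oq sprod_fst (@top_ext C A)) (sprod_snd (@top_ext C A)).
exists h; split=> //; apply: comp_eq => r [c x] [phi x'] y hu.
case/forceI_inv => F xy; have /sprod_eqP[pp xx _] := hom_cod hu.
have k : r <= prod_fst ((phi, x') : EA) phi by apply: forceI => //; exact: hom_cod hu.
have e := square_inv h1 hu k; pick e Qfr c' l.
case/forceI_inv: l => /forceI_inv[cxx cc'] /curry_relP[_ _ g].
have k' : r <= prod_snd ((phi, x') : EA) x' by apply: forceI => //; exact: hom_cod hu.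
have /forceI_inv[_ xx'] := comp_in h2 hu k'.
apply: hom_extl (_ : r <= f (c', x') y) _; first exact/(g r _ _ (lexx r)).
by apply/sprod_eqP; split; [exact: qeqC | exact: qeqC | exact: force1].
Qed.

Lemma curry_unique (g : qhom C expq) (h : qhom (prodq C A) EA) :
  prod_fst \oq h = g \oq prod_fst -> prod_snd \oq h = prod_snd ->
  ev \oq h = f -> g = curry.
Proof.
move=> h1 h2 h3; apply: hom_le_eq => r c phi cp.
have cc := hom_dom cp; have /exp_eqP[F _ _] := hom_cod cp.
(* [h] is [g * A]: where [g c phi] holds, it sends [(c, x)] to [(phi, x)] *)
have hE s x : s <= r -> s <= qeq x x -> s <= h (c, x) (phi, x).
  move=> sr xx; have {}cc := le_trans sr cc; have {}cp := le_trans sr cp.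
  have ux := prod_extent cc xx.
  have k : s <= prod_fst ((c, x) : prodq C A) c by apply: forceI.
  have e := square_inv (esym h1) k cp; pick e Qfr u l.
  case/forceI_inv: l => hu /forceI_inv[uu u1].
  have /sprod_eqP[_ u22 _] := uu.
  have k2 : s <= prod_snd u u.2 by apply: forceI.
  have /forceI_inv[_ u2] := comp_in h2 hu k2.
  apply: (hom_extr hu); apply/sprod_eqP; split=> //; last exact: force1.
  exact: qeqC.
apply/curry_relP; split=> // s x y sr; have sF := le_trans sr F; split=> [xy|fxy].
  have [xx _] := isfun_strict sF xy.
  by apply: (comp_in h3 (hE _ _ sr xx)); apply: forceI.
have /sprod_eqP[_ xx _] := hom_dom fxy.
have e := comp_out h3 fxy; pick e Qfr u l; case/forceI_inv: l => hu /forceI_inv[_ uy].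
have /sprod_eqP[/exp_eqP[_ _ k] xu _] := hom_sv (hE _ _ sr xx) hu.
apply/(k s _ _ (lexx s)); have /sprod_eqP[/exp_eqP[G _ _] _ _] := hom_cod hu.
by apply: (isfun_ext G uy (qeqC xu)); have [] := isfun_strict G uy.
Qed.

End Transpose.

(** The transpose of [f] sends [c] to the relation [f (c, -)]; uniqueness is
    extensionality of relations. *)
Lemma expq_exponential :
  @is_exponential (QSetCat Qdiv) A B expq EA prod_fst prod_snd ev.
Proof.
apply: chosen_exponential; first exact: prodq_product.
move=> C; exists (prodq C A), prod_fst, prod_snd; split; first exact: prodq_product.
move=> f; exists (curry f); split; first exact: curry_ev.
by move=> g [h [h1 h2 h3]]; rewrite (curry_unique h1 h2 h3).
Qed.

End Exponential.

Lemma frame_topos : elementary_topos (QSetCat Qdiv).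
Proof.
split.
- by exists one_qset; apply: one_terminal.
- by move=> A B C f g; do 3!eexists; apply: sprod_pullback.
- by move=> A B; do 5!eexists; apply: expq_exponential.
- by do 3!eexists; apply: omega_classifier.
Qed.

End Frame.

(** * The characterization *)

Theorem theorem5p6 (d : Order.disp_t) (Q : commQuantaleType d)
    (Qdiv : divisible Q) :
  elementary_topos (QSetCat Qdiv) <-> is_frame Q.
Proof.
split=> [[_ _ _ om]|Qfr]; first exact: classifier_is_frame om.
exact: frame_topos.
Qed.
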